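(* Let $\mathcal{H}=\bigoplus_{j=1}^k V_j$ be an orthogonal decomposition of a finite-dimensional Hilbert space with orthogonal projections $P_j$ onto $V_j$, and let $(p_i,\rho_i)_{i=1}^N$ be an ensemble of quantum states on $\mathcal{H}$ that are all block-diagonal with respect to this decomposition, i.e. $\rho_i=\sum_{j=1}^k P_j\rho_iP_j$ for all $i$. Put $q_{ij}=\operatorname{tr}(P_j\rho_i)$, $s_j=\sum_i p_iq_{ij}$ and assume $s_j>0$ for all $j$; let $\rho_{ij}=P_j\rho_iP_j/q_{ij}$, regarded as a state on $V_j$ (an arbitrary state on $V_j$ if $q_{ij}=0$), and $p_{ij}=p_iq_{ij}/s_j$. Then an optimal discrimination measurement for $(p_i,\rho_i)_{i}$ is obtained by first measuring the projective measurement $(P_j)_{j=1}^k$ and then, upon outcome $j$, discriminating optimally among the projected states in the block $V_j$. That is, if $(M_{ij})_{i=1}^N$ is an optimal POVM on $V_j$ for the ensemble $(p_{ij},\rho_{ij})_{i=1}^N$ for each $j$, then $M_i=\bigoplus_{j=1}^k M_{ij}$, $i=1,\dots,N$, is an optimal POVM for discriminating $(p_i,\rho_i)_{i=1}^N$.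
   Context: A quantum state is a positive semidefinite operator of unit trace on a finite-dimensional complex Hilbert space. An ensemble $(p_i,\rho_i)_{i=1}^N$ consists of quantum states $\rho_i$ and a probability distribution $(p_i)$. A POVM is a family $(M_i)_{i=1}^N$ of positive semidefinite operators with $\sum_i M_i=\mathbb{I}$. A POVM is optimal for discriminating the ensemble if it maximizes the success probability $\sum_{i=1}^N p_i\operatorname{tr}(M_i\rho_i)$ over all POVMs. *)

(* Defs.v *)
From HB Require Import structures.
From mathcomp Require Import all_boot all_order all_algebra.
From mathcomp Require Import reals complex.

Set Implicit Arguments.
Unset Strict Implicit.
Unset Printing Implicit Defensive.

Import Order.TTheory GRing.Theory Num.Theory.

Local Open Scope ring_scope.

(* A finite-dimensional complex Hilbert space is a vector space H over the
   complex numbers R[i] with an inner product dot : {dot H for Num.conj}, which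
   is linear in its first argument.  In the order on R[i], 0 <= z means that z is
   real and nonnegative, so probabilities are elements of R[i]. *)

Section States.
Variables (R : realType) (H : vectType R[i]).

Definition lftrace (A : 'End(H)) : R[i] :=
  \tr (passmx.mxof (vbasis fullv) (vbasis fullv) A).

Variable dot : {dot H for Num.conj}.

(* Over R[i] this positivity forces A to be self-adjoint. *)
Definition psd (A : 'End(H)) : Prop := forall v : H, 0 <= dot (A v) v.

Definition is_state (rho : 'End(H)) : Prop := psd rho /\ lftrace rho = 1.

Definition is_distribution (N : nat) (p : 'I_N -> R[i]) : Prop :=
  (forall i, 0 <= p i) /\ \sum_i p i = 1.

Definition is_ensemble (N : nat) (p : 'I_N -> R[i]) (rho : 'I_N -> 'End(H)) :
    Prop :=
  is_distribution p /\ forall i, is_state (rho i).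

Definition is_povm (N : nat) (M : 'I_N -> 'End(H)) : Prop :=
  (forall i, psd (M i)) /\ \sum_i M i = \1%VF.

Definition success_prob (N : nat) (p : 'I_N -> R[i])
    (rho M : 'I_N -> 'End(H)) : R[i] :=
  \sum_i p i * lftrace (M i \o rho i)%VF.

Definition optimal_povm (N : nat) (p : 'I_N -> R[i])
    (rho M : 'I_N -> 'End(H)) : Prop :=
  is_povm M /\
  forall M' : 'I_N -> 'End(H), is_povm M' ->
    success_prob p rho M' <= success_prob p rho M.

(* The projection onto W along its orthogonal complement. *)
Definition orthoproj (W : {vspace H}) : 'End(H) := daddv_pi W (orthov dot W).

Definition orthogonal_decomposition (k : nat) (V : 'I_k -> {vspace H}) : Prop :=
  (forall j l, j != l -> (V j <= orthov dot (V l))%VS) /\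
  (\sum_j V j)%VS = fullv.

(* An operator on H whose range lies in W, regarded as an operator on W.  The
   map vsproj W projects along an unspecified complement of W, so the range
   condition is needed; block_sum applies orthoproj first for this reason. *)
Definition block_of (W : {vspace H}) (A : 'End(H)) : 'End(subvs_of W) :=
  (linfun (vsproj W) \o A \o linfun vsval)%VF.

(* The operator \sum_j v_j |-> \sum_j A_j v_j, for v_j in V_j. *)
Definition block_sum (k : nat) (V : 'I_k -> {vspace H})
    (A : forall j, 'End(subvs_of (V j))) : 'End(H) :=
  \sum_j (linfun vsval \o A j \o linfun (vsproj (V j)) \o orthoproj (V j))%VF.

End States.

Section SubspaceDot.
Variables (R : realType) (H : vectType R[i]) (dot : {dot H for Num.conj}).
Variable W : {vspace H}.

Definition subdot (u v : subvs_of W) : R[i] := dot (vsval u) (vsval v).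

Fact subdot_bilinear : bilinear_for *%R (Num.conj \; *%R) subdot.
Proof.
split=> w a u v; rewrite /subdot.
- by have := linearPl dot (vsval w) a (vsval u) (vsval v).
- by have := linearPr dot (vsval w) a (vsval u) (vsval v).
Qed.

HB.instance Definition _ := bilinear_isBilinear.Build _ _ _ _ _ _ subdot
  subdot_bilinear.

Fact subdot_hermitian (u v : subvs_of W) :
  subdot u v = (-1) ^+ false * Num.conj (subdot v u).
Proof. exact: hermC. Qed.

HB.instance Definition _ := @isHermitianSesquilinear.Build _ _ _ _ subdot
  subdot_hermitian.

Fact subdot_gt0 (u : subvs_of W) : u != 0 -> 0 < subdot u u.
Proof.
by rewrite /subdot dnorm_gt0; apply: contra => /eqP u0; rewrite -val_eqE /= u0.
Qed.

HB.instance Definition _ := isDotProduct.Build _ _ subdot subdot_gt0.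

End SubspaceDot.

(* Main.v *)
From HB Require Import structures.
Require Import Defs.
From mathcomp Require Import all_boot all_order all_algebra.
From mathcomp Require Import reals complex ring.

Import Order.TTheory GRing.Theory Num.Theory.

Local Open Scope ring_scope.

Set Implicit Arguments.
Unset Strict Implicit.
Unset Printing Implicit Defensive.

(* Write i_j for the inclusion of V_j in H and pi_j for its adjoint, so that
   i_j pi_j = P_j.  By cyclicity of the trace, block-diagonality of rho_i gives
   tr (M_i rho_i) = \sum_j tr ((pi_j M_i i_j) (pi_j rho_i i_j)), and
   pi_j rho_i i_j = q_ij rho_ij; when q_ij = 0 this holds because a positive
   operator of trace zero vanishes.  Hence the success probability of any POVM is
   the s_j-weighted sum of those of its compressions to the blocks, which are
   POVMs on V_j, while the compressions of the direct sum are the given optimal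
   POVMs. *)

(** * Cyclicity and basis independence of the trace *)

Section Trace.
Variable R : realType.

(** Two spaces are allowed so that the inclusion of a block and its adjoint can be cycled. *)
Lemma lftraceC (U H : vectType R[i]) (A : 'Hom(U, H)) (B : 'Hom(H, U)) :
  lftrace (A \o B)%VF = lftrace (B \o A)%VF.
Proof.
by rewrite /lftrace !(passmx.mxof_comp _ _ (vbasisP _)) mxtrace_mulC.
Qed.

Lemma lftrace_sandwich (U H : vectType R[i]) (f : 'Hom(U, H)) (g : 'Hom(H, U))
    (A B : 'End(H)) :
  lftrace (A \o ((f \o g) \o B \o (f \o g)))%VF =
  lftrace ((g \o A \o f) \o (g \o B \o f))%VF.
Proof. by rewrite !comp_lfunA [LHS]lftraceC !comp_lfunA. Qed.

Lemma lftrace_linear (H : vectType R[i]) : linear (@lftrace R H).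
Proof. by move=> a A B; rewrite /lftrace passmx.mxof_linear mxtraceD mxtraceZ. Qed.

HB.instance Definition _ (H : vectType R[i]) :=
  GRing.isSemilinear.Build _ _ _ _ (@lftrace R H)
    (GRing.semilinear_linear (@lftrace_linear H)).

Lemma lftraceE (H : vectType R[i]) (e : (\dim {:H}).-tuple H) (A : 'End(H)) :
  basis_of {:H} e -> lftrace A = \sum_i coord e i (A e`_i).
Proof.
move=> eb; transitivity (\tr (passmx.mxof e e A)).
  (* Factoring [A] as [\1 \o A] through the basis [e] makes the change-of-basis matrix a factor that
     can be cycled. *)
  rewrite /lftrace -[in LHS](comp_lfun1l A).
  rewrite (passmx.mxof_comp _ _ eb) mxtrace_mulC.
  by rewrite -(passmx.mxof_comp _ _ (vbasisP _)) comp_lfun1r.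
by apply: eq_bigr => i _; rewrite !mxE /= passmx.vecof_delta.
Qed.

End Trace.

(** * Positive operators of trace zero *)

Section Psd.
Variables (R : realType) (H : vectType R[i]) (dot : {dot H for Num.conj}).

(** Gram-Schmidt without normalization: while fewer than dim H vectors are chosen, some [b] lies
    outside their span, and its orthogonal component [Y] is nonzero. *)
Lemma orthogonal_basis : exists2 e : (\dim {:H}).-tuple H,
  basis_of {:H} e & pairwise_orthogonal dot e.
Proof.
suff ind n : (n <= \dim {:H})%N ->
    exists2 s : n.-tuple H, free s & pairwise_orthogonal dot s.
  have [e fe oe] := ind _ (leqnn _); exists e => //.
  by rewrite basisEfree fe subvf size_tuple /=.
elim: n => [_|n IHn ltn]; first by exists [tuple] => //; rewrite nil_free.
have [s fs os] := IHn (ltnW ltn).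
have /subvPn[b _ bs] : ~~ (fullv <= <<s>>)%VS.
  apply: contraL ltn => /dimvS; rewrite -leqNgt => /leq_trans; apply.
  by rewrite (leq_trans (dim_span _)) ?size_tuple.
have [X sX [Y [eb _ oY]]] := orthogonal_split dot s b.
have oYs : pairwise_orthogonal dot (Y :: s).
  rewrite -cat1s pairwise_orthogonal_cat os oY !andbT /pairwise_orthogonal /=.
  rewrite inE andbT; apply: contra bs => /eqP Y0.
  by rewrite eb -Y0 addr0.
by exists [tuple of Y :: s] => //; apply: orthogonal_free oYs.
Qed.

Lemma psd_dot_eq0 (A : 'End(H)) (u : H) :
  psd dot A -> dot (A u) u = 0 -> A u = 0.
Proof.
move=> psdA Au0.
(* Positivity at u + t v for t = 1, -1 makes x real; then t = - x / (c + 1)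
   gives - (x / (c + 1)) ^+ 2 >= 0. *)
have quad v : dot (A u) v + dot (A v) u = 0.
  set x := LHS; set c := dot (A v) v.
  have c_ge0 : 0 <= c := psdA v.
  have h t : t \is Num.real -> 0 <= t * x + t ^+ 2 * c.
    move=> tr; have := psdA (u + t *: v).
    have -> : A (u + t *: v) = A u + t *: A v by rewrite linearD linearZ.
    rewrite linearDl !linearDr /= Au0 add0r.
    rewrite !linearZl_LR !linearZr_LR /= (CrealP tr).
    by rewrite -/c mulrA -expr2 addrA -mulrDr.
  have xr : x \is Num.real.
    have := h 1 (rpred1 _); rewrite mul1r expr1n mul1r => /ger0_real xc.
    by rewrite -(addrK c x) rpredB // ger0_real.
  have c1_gt0 : 0 < c + 1 by rewrite ltr_wpDl.
  have c1r : c + 1 \is Num.real by rewrite gtr0_real.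
  have := h (- x / (c + 1)); rewrite rpredM ?rpredN ?rpredV // => /(_ isT).
  have -> : - x / (c + 1) * x + (- x / (c + 1)) ^+ 2 * c
          = - (x / (c + 1)) ^+ 2 by field; rewrite gt_eqF.
  rewrite oppr_ge0 => x0; apply/eqP; move: x0.
  rewrite real_exprn_even_le0 ?rpredM ?rpredV //= mulf_eq0 invr_eq0.
  by rewrite (gt_eqF c1_gt0) orbF.
(* Replacing v by i v multiplies the two terms of [quad] by -i and i, so their difference vanishes
   as well as their sum. The choice v = A u then concludes. *)
have orth v : dot (A u) v = 0.
  have := quad ('i *: v); have /eqP := quad v.
  have -> : A ('i *: v) = 'i *: A v by rewrite linearZ.
  rewrite linearZr_LR linearZl_LR /= conjCi addr_eq0 => /eqP ->.
  rewrite mulrNN -mulrDr => /eqP; rewrite mulf_eq0 (negPf (neq0Ci _)) /=.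
  by rewrite -mulr2n mulrn_eq0 /= => /eqP ->; rewrite oppr0.
by apply/eqP; rewrite -(dnorm_eq0 dot) orth.
Qed.

(** In an orthogonal basis the diagonal coordinates are (A e, e) / (e, e) >= 0. Their sum is zero,
    so each vanishes, and [psd_dot_eq0] gives A e = 0. *)
Lemma psd_lftrace_eq0 (A : 'End(H)) : psd dot A -> lftrace A = 0 -> A = 0.
Proof.
move=> psdA; have [e eb oe] := orthogonal_basis.
have dotE (i : 'I_(\dim {:H})) : dot (A e`_i) e`_i = coord e i (A e`_i) * dot e`_i e`_i.
  rewrite {1}(coord_basis eb (memvf (A e`_i))) linear_sumlz (bigD1 i) //=.
  rewrite linearZl_LR big1 ?addr0 // => j ji; rewrite linearZl_LR.
  have /pairwise_orthogonalP[/= /andP[_ ue] ->] := oe; rewrite ?mulr0 //.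
  - by rewrite mem_nth ?size_tuple.
  - by rewrite mem_nth ?size_tuple.
  - by rewrite nth_uniq ?size_tuple.
have e_gt0 (i : 'I_(\dim {:H})) : 0 < dot e`_i e`_i.
  rewrite dnorm_gt0; apply: contraTneq oe => /eqP e0.
  rewrite /pairwise_orthogonal negb_and negbK; apply/orP; left.
  by rewrite -(eqP e0) mem_nth ?size_tuple.
have c_ge0 i : 0 <= coord e i (A e`_i).
  by rewrite -(pmulr_lge0 _ (e_gt0 i)) -dotE; apply: psdA.
rewrite (lftraceE A eb) => /eqP; rewrite psumr_eq0 // => /allP c0.
apply/lfunP => v; rewrite lfunE /= (coord_basis eb (memvf v)) linear_sum.
rewrite big1 // => i _; rewrite linearZ /= psd_dot_eq0 ?scaler0 //.
by rewrite dotE (eqP (c0 i _)) ?mul0r // mem_index_enum.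
Qed.

End Psd.

(** * Orthogonal projections and compressions to a subspace *)

Section OrthogonalProjection.
Variables (R : realType) (H : vectType R[i]) (dot : {dot H for Num.conj}).
Variable W : {vspace H}.

Lemma capv_orthov : (W :&: orthov dot W = 0)%VS.
Proof.
apply/eqP; rewrite -subv0; apply/subvP => v /memv_capP[vW /mem_orthovP vo].
by rewrite memv0 -(dnorm_eq0 dot) vo.
Qed.

Lemma addv_orthov : (W + orthov dot W = fullv)%VS.
Proof.
apply/eqP; rewrite eqEsubv subvf; apply/subvP => v _.
have [X sX [Y [-> _ oY]]] := orthogonal_split dot (vbasis W) v.
rewrite memv_add //; first by rewrite -(span_basis (vbasisP W)).
apply/mem_orthovP => w; rewrite -(span_basis (vbasisP W)) => wW.
exact: (span_orthogonal oY (memv_span1 Y) wW).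
Qed.

Lemma orthoproj_mem v : orthoproj dot W v \in W.
Proof. exact: memv_pi. Qed.

Lemma orthoproj_id v : v \in W -> orthoproj dot W v = v.
Proof. exact: daddv_pi_id capv_orthov. Qed.

Lemma orthoproj_compl v : v - orthoproj dot W v \in orthov dot W.
Proof.
rewrite -{1}[v](daddv_pi_add capv_orthov) ?addv_orthov ?memvf //.
by rewrite addrC addKr memv_pi.
Qed.

(** P v = v - (v - P v) lies both in W and in its orthogonal complement. *)
Lemma orthoproj_eq0 v : v \in orthov dot W -> orthoproj dot W v = 0.
Proof.
move=> vo; apply/eqP; rewrite -memv0 -capv_orthov memv_cap orthoproj_mem /=.
by rewrite -[X in X \in _](subKr v) rpredB ?orthoproj_compl.
Qed.

Lemma dot_orthoprojl u v : u \in W -> dot (orthoproj dot W v) u = dot v u.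
Proof.
move=> uW; apply/eqP; rewrite eq_sym -subr_eq0 -linearBl.
by apply/eqP; exact: (mem_orthovP (orthoproj_compl v) _ uW).
Qed.

Lemma dot_orthoprojr u v : u \in W -> dot u (orthoproj dot W v) = dot u v.
Proof.
move=> uW; apply/eqP; rewrite eq_sym -subr_eq0 -linearBr herm_eq0C.
by apply/eqP; exact: (mem_orthovP (orthoproj_compl v) _ uW).
Qed.

(** The adjoint of the inclusion of W, as [subdot_orthoproj_sub] shows; it is pi_j when W = V_j. *)
Definition orthoproj_sub : 'Hom(H, subvs_of W) :=
  (linfun (vsproj W) \o orthoproj dot W)%VF.

Lemma vsval_orthoproj_sub v : vsval (orthoproj_sub v) = orthoproj dot W v.
Proof. by rewrite comp_lfunE lfunE vsprojK ?orthoproj_mem. Qed.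

Lemma orthoproj_subK : (orthoproj_sub \o linfun vsval)%VF = \1%VF.
Proof.
apply/lfunP => u; apply/val_inj; rewrite comp_lfunE /= vsval_orthoproj_sub.
by rewrite !lfunE /= orthoproj_id ?subvsP.
Qed.

Lemma vsval_orthoproj_subE :
  (linfun vsval \o orthoproj_sub)%VF = orthoproj dot W.
Proof.
by apply/lfunP => v; rewrite comp_lfunE [LHS]lfunE /= vsval_orthoproj_sub.
Qed.

Lemma subdot_orthoproj_sub v u :
  subdot dot (orthoproj_sub v) u = dot v (vsval u).
Proof. by rewrite /subdot vsval_orthoproj_sub dot_orthoprojl ?subvsP. Qed.

Lemma subdot_orthoproj_subr u v :
  subdot dot u (orthoproj_sub v) = dot (vsval u) v.
Proof. by rewrite /subdot vsval_orthoproj_sub dot_orthoprojr ?subvsP. Qed.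

(** Unlike [block_of], this is the diagonal block of an arbitrary operator, since it projects
    orthogonally first. *)
Definition compress (A : 'End(H)) : 'End(subvs_of W) :=
  (orthoproj_sub \o A \o linfun vsval)%VF.

Lemma compressE A v : compress A v = orthoproj_sub (A (vsval v)).
Proof. by rewrite /compress 2!comp_lfunE [linfun vsval v]lfunE. Qed.

Lemma compress_is_linear : linear compress.
Proof.
move=> a A B; apply/lfunP => v.
by rewrite !(add_lfunE, scale_lfunE, compressE) linearP.
Qed.

HB.instance Definition _ := GRing.isSemilinear.Build _ _ _ _ compress
  (GRing.semilinear_linear compress_is_linear).

Lemma compress1 : compress \1%VF = \1%VF.
Proof. by rewrite /compress comp_lfun1r orthoproj_subK. Qed.

Lemma psd_compress A : psd dot A -> psd (subdot dot (W := W)) (compress A).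
Proof.
move=> psdA v.
change (0 <= subdot dot (compress A v) v); rewrite compressE subdot_orthoproj_sub.
exact: psdA.
Qed.

(** Identifies q_ij as the trace of the compression of rho_i to V_j. *)
Lemma lftrace_compress A :
  lftrace (compress A) = lftrace (orthoproj dot W \o A)%VF.
Proof.
by rewrite /compress [LHS]lftraceC comp_lfunA vsval_orthoproj_subE.
Qed.

Lemma psd_compress_eq0 A :
  psd dot A -> lftrace (orthoproj dot W \o A)%VF = 0 -> compress A = 0.
Proof.
move=> /psd_compress psdA; rewrite -lftrace_compress.
exact: psd_lftrace_eq0 psdA.
Qed.

(** The range of P A P lies in W, where the complement chosen by [vsproj] has no effect. *)
Lemma block_of_orthoproj A :
  block_of W (orthoproj dot W \o A \o orthoproj dot W)%VF = compress A.
Proof.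
apply/lfunP => v; rewrite !comp_lfunE [linfun vsval v]lfunE /=.
by rewrite (orthoproj_id (subvsP v)).
Qed.

End OrthogonalProjection.

(** * Direct sums of operators over the blocks *)

Section Decomposition.
Variables (R : realType) (H : vectType R[i]) (dot : {dot H for Num.conj}).
Variables (k : nat) (V : 'I_k -> {vspace H}).
Hypothesis decV : orthogonal_decomposition dot V.

Local Notation P j := (orthoproj dot (V j)).

Lemma sum_orthoproj : \sum_j P j = \1%VF.
Proof.
apply/lfunP => v; have := memvf v; rewrite -decV.2 => /memv_sumP[w wV ->].
rewrite lfunE linear_sum /=; apply: eq_bigr => l _; rewrite sum_lfunE.
have P0 j : j != l -> P j (w l) = 0.
  by move=> jl; rewrite orthoproj_eq0 // (subvP (decV.1 l j _)) ?wV // eq_sym.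
by rewrite (bigD1 l) //= [X in _ + X]big1 // addr0 (orthoproj_id dot (wV l isT)).
Qed.

Lemma block_sumE (A : forall j, 'End(subvs_of (V j))) v :
  block_sum dot A v = \sum_j vsval (A j (orthoproj_sub dot (V j) v)).
Proof.
rewrite /block_sum sum_lfunE; apply: eq_bigr => j _.
by rewrite -comp_lfunA 2!comp_lfunE lfunE.
Qed.

(** By adjointness the quadratic form at v is the sum of the forms of the [A j] at the pi_j v. *)
Lemma psd_block_sum (A : forall j, 'End(subvs_of (V j))) :
  (forall j, psd (subdot dot (W := V j)) (A j)) -> psd dot (block_sum dot A).
Proof.
move=> psdA v; rewrite block_sumE linear_sumlz sumr_ge0 // => j _.
set w := orthoproj_sub dot (V j) v.
have : 0 <= subdot dot (A j w) w := psdA j w.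
by rewrite subdot_orthoproj_subr.
Qed.

Lemma block_sum1 : block_sum dot (fun j => \1%VF : 'End(subvs_of (V j))) = \1%VF.
Proof.
rewrite /block_sum -sum_orthoproj; apply: eq_bigr => j _.
by rewrite comp_lfun1r -comp_lfunA vsval_orthoproj_subE.
Qed.

Lemma sum_block_sum (N : nat) (A : forall j, 'I_N -> 'End(subvs_of (V j))) :
  \sum_i block_sum dot (fun j => A j i) = block_sum dot (fun j => \sum_i A j i).
Proof.
apply/lfunP => v; rewrite sum_lfunE block_sumE.
under eq_bigr => i _ do rewrite block_sumE.
rewrite exchange_big; apply: eq_bigr => j _.
by rewrite sum_lfunE linear_sum.
Qed.

(** For l != j the l-th summand has values in V_l, which is orthogonal to V_j. *)
Lemma compress_block_sum (A : forall j, 'End(subvs_of (V j))) j :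
  compress dot (V j) (block_sum dot A) = A j.
Proof.
apply/lfunP => u; apply/val_inj; rewrite compressE /= vsval_orthoproj_sub.
rewrite block_sumE linear_sum (bigD1 j) //= big1 => [|l lj].
  rewrite addr0 orthoproj_id ?subvsP //; congr (vsval (A j _)).
  by apply/val_inj; rewrite /= vsval_orthoproj_sub orthoproj_id ?subvsP.
by rewrite orthoproj_eq0 // (subvP (decV.1 l j lj)) ?subvsP.
Qed.

(** [A] is arbitrary: its off-diagonal blocks do not contribute to the trace against a
    block-diagonal [B]. *)
Lemma lftrace_block_diagonal (A B : 'End(H)) :
  B = \sum_j (P j \o B \o P j)%VF ->
  lftrace (A \o B)%VF =
  \sum_j lftrace (compress dot (V j) A \o compress dot (V j) B)%VF.
Proof.
move=> Bdiag; rewrite [in LHS]Bdiag.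
have -> : (A \o \sum_j (P j \o B \o P j))%VF =
    \sum_j (A \o (P j \o B \o P j))%VF.
  apply/lfunP => v; rewrite comp_lfunE !sum_lfunE linear_sum.
  by apply: eq_bigr => j _; rewrite comp_lfunE.
rewrite linear_sum; apply: eq_bigr => j _ /=.
by rewrite -vsval_orthoproj_subE lftrace_sandwich.
Qed.

End Decomposition.

Lemma is_povm_compress (R : realType) (H : vectType R[i])
    (dot : {dot H for Num.conj}) (W : {vspace H}) (N : nat)
    (M : 'I_N -> 'End(H)) :
  is_povm dot M -> is_povm (subdot dot (W := W)) (fun i => compress dot W (M i)).
Proof.
move=> [psdM sumM]; split; first by move=> i; apply: psd_compress.
by rewrite -linear_sum sumM /= compress1.
Qed.

Unset Implicit Arguments.
Theorem corollary2 (R : realType) (H : vectType R[i]) (dot : {dot H for Num.conj})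
    (k : nat) (V : 'I_k -> {vspace H})
    (N : nat) (p : 'I_N -> R[i]) (rho : 'I_N -> 'End(H))
    (rhoV : forall j : 'I_k, 'I_N -> 'End(subvs_of (V j)))
    (M : forall j : 'I_k, 'I_N -> 'End(subvs_of (V j))) :
  let P j := orthoproj dot (V j) in
  let q i j := lftrace (P j \o rho i)%VF in
  let s j := \sum_i p i * q i j in
  let pV j i := p i * q i j / s j in
  orthogonal_decomposition dot V ->
  is_ensemble dot p rho ->
  (forall i, rho i = \sum_j (P j \o rho i \o P j)%VF) ->
  (forall j, 0 < s j) ->
  (forall i j, q i j != 0 ->
     rhoV j i = block_of (V j) ((q i j)^-1 *: (P j \o rho i \o P j)%VF)) ->
  (forall i j, q i j = 0 -> is_state (subdot dot (W := V j)) (rhoV j i)) ->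
  (forall j, optimal_povm (subdot dot (W := V j)) (pV j) (rhoV j) (M j)) ->
  optimal_povm dot p rho (fun i => block_sum dot (fun j => M j i)).
Proof.
move=> P q s pV decV [_ rho_st] rhoE s_gt0 rhoVE _ optM.
have compress_rho j i : compress dot (V j) (rho i) = q i j *: rhoV j i.
  (* If q_ij = 0, the state [rhoV j i] is arbitrary, but both sides vanish. *)
  have [q0|qN0] := eqVneq (q i j) 0.
    by rewrite q0 scale0r; apply: (psd_compress_eq0 (rho_st i).1).
  rewrite rhoVE // -block_of_orthoproj -/(P j).
  apply/lfunP => v; rewrite /block_of; do !rewrite ?comp_lfunE lfunE /=.
  by rewrite linearZ /= scalerA mulfV ?scale1r.
have successE M' : success_prob p rho M' =
    \sum_j s j * success_prob (pV j) (rhoV j) (fun i => compress dot (V j) (M' i)).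
  rewrite /success_prob.
  under eq_bigr => i _ do rewrite (lftrace_block_diagonal (M' i) (rhoE i)) mulr_sumr.
  rewrite exchange_big; apply: eq_bigr => j _; rewrite mulr_sumr.
  apply: eq_bigr => i _; rewrite /= compress_rho -comp_lfunZr linearZ /=.
  (* The factor s_j cancels the normalization of p_ij, leaving p_i q_ij. *)
  by rewrite /pV mulrA [s j * _]mulrC divfK ?lt0r_neq0 // mulrA.
split; first split.
- by move=> i; apply: psd_block_sum => j; apply: (optM j).1.1.
(* In each block the [M j i] sum to the identity, and the direct sum of these identities is \sum_j
   P_j = 1. *)
- rewrite sum_block_sum -(block_sum1 decV) /block_sum.
  by apply: eq_bigr => j _; rewrite (optM j).1.2.
(* The weights s_j are positive, so it suffices to compare, in each block, the compression of [M']
   with the optimal [M j]. *)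
move=> M' povmM'; rewrite !successE; apply: ler_sum => j _.
apply: ler_wpM2l; first exact: ltW.
have -> : success_prob (pV j) (rhoV j)
    (fun i => compress dot (V j) (block_sum dot (fun l => M l i))) =
    success_prob (pV j) (rhoV j) (M j).
  by apply: eq_bigr => i _; rewrite compress_block_sum.
by apply: (proj2 (optM j)); apply: is_povm_compress.
Qed.
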